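(* There exists a universal constant $C>0$ such that the following holds. Let $B\subset\mathbb{R}^d$ be the $d$-dimensional Euclidean unit ball, let $R_1,\ldots,R_k\in\mathbb{R}$, and for $i\in\{1,\ldots,k\}$ let $$F_i=\{x\mapsto w\cdot x+b\ :\ w\in\mathbb{R}^d,\ b\in\mathbb{R},\ \max\{\|w\|,|b|\}\le R_i\}$$ be the class of $R_i$-bounded affine functions on the domain $\Omega=B$. Let $G:\mathbb{R}^k\to\mathbb{R}$ be an aggregation rule that is $L$-Lipschitz with respect to the supremum norm. Then $$\mathrm{fat}_\gamma(G(F_1,\ldots,F_k))\le\frac{C L^2\,\mathrm{Log}(k)}{\gamma^2}\sum_{i=1}^k R_i^2,\qquad 0<\gamma/L<\min_{i\in\{1,\ldots,k\}}R_i.$$ Further, if for each $i$ $$F_i^{\mathrm{Hinge}}=\{(x,y)\mapsto\max\{0,1-y f(x)\}\ :\ f\in F_i\}$$ is the class of $R_i$-bounded hinge-loss affine functions on $B\times\{-1,1\}$, then the same bound (for the same range of $\gamma$) holds for $\mathrm{fat}_\gamma(G(F_1^{\mathrm{Hinge}},\ldots,F_k^{\mathrm{Hinge}}))$.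
   Context: $\|\cdot\|$ is the Euclidean norm, $\log$ is the natural logarithm and $\mathrm{Log}(x):=\log(\max\{e,x\})$. An aggregation rule is any mapping $G:\mathbb{R}^k\to\mathbb{R}$; for classes $F_1,\ldots,F_k\subseteq\mathbb{R}^\Omega$, $$G(F_1,\ldots,F_k):=\{x\mapsto G(f_1(x),\ldots,f_k(x)) : f_i\in F_i,\ i\in\{1,\ldots,k\}\}.$$ $G$ is $L$-Lipschitz in supremum norm if $|G(x)-G(x')|\le L\max_{i}|x_i-x_i'|$ for all $x,x'\in\mathbb{R}^k$. Fat-shattering dimension: for $F\subset\mathbb{R}^\Omega$ and $\gamma>0$, a finite set $S=\{x_1,\ldots,x_m\}\subset\Omega$ is $\gamma$-shattered by $F$ if $$\sup_{r\in\mathbb{R}^m}\ \min_{y\in\{-1,1\}^m}\ \sup_{f\in F}\ \min_{i\in\{1,\ldots,m\}} y_i(f(x_i)-r_i)\ \ge\ \gamma,$$ and $\mathrm{fat}_\gamma(F)$ is the size of the largest $\gamma$-shattered set (possibly $\infty$). *)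

(* Defs.v *)
From HB Require Import structures.
From mathcomp Require Import all_boot all_order all_algebra.
From mathcomp Require Import all_classical all_reals all_analysis.

Set Implicit Arguments.
Unset Strict Implicit.
Unset Printing Implicit Defensive.

Import Order.TTheory GRing.Theory Num.Theory.
Import numFieldNormedType.Exports.

Local Open Scope classical_set_scope.
Local Open Scope ring_scope.

Definition Log (R : realType) (x : R) : R := ln (Num.max (expR 1) x).

Definition dotp (R : realType) (d : nat) (u v : 'rV[R]_d) : R :=
  \sum_(j < d) u 0 j * v 0 j.

(* The canonical norm `|u| on 'rV[R]_d is the supremum norm, so the Euclidean
   norm needs its own name. *)
Definition enorm (R : realType) (d : nat) (u : 'rV[R]_d) : R :=
  Num.sqrt (dotp u u).

Definition unit_ball (R : realType) (d : nat) : Type :=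
  {x : 'rV[R]_d | enorm x <= 1}.

(* The minimum over y in {-1,1}^m is taken over Boolean vectors, with y_i
   rendered as (-1) ^+ y i. Suprema and minima are computed in \bar R, where the
   minimum over an empty index set is +oo and the supremum over an empty class
   is -oo. *)
Definition shattered (R : realType) (T : Type) (F : set (T -> R)) (gamma : R)
    (m : nat) (x : 'I_m -> T) : Prop :=
  (gamma%:E <=
   ereal_sup
     [set \big[mine/+oo]_(y : {ffun 'I_m -> bool})
            ereal_sup
              [set \big[mine/+oo]_(i < m)
                     ((-1) ^+ y i * (f (x i) - r i))%:E | f in F]
     | r in [set: 'I_m -> R]])%E.

(* A set of size m is given by an injective enumeration of its points. As
   cardinalities are integers, the supremum is a maximum unless it is +oo.
   If F is non-empty, the empty set is shattered, so the value is at least 0. *)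
Definition fat (R : realType) (T : Type) (gamma : R) (F : set (T -> R)) :
    \bar R :=
  ereal_sup [set (m%:R : R)%:E | m in
    [set m : nat | exists x : 'I_m -> T, injective x /\ shattered F gamma x]].

Definition aggregate (R : realType) (T : Type) (k : nat) (G : 'rV[R]_k -> R)
    (F : 'I_k -> set (T -> R)) : set (T -> R) :=
  [set g | exists f : 'I_k -> (T -> R),
    (forall i, F i (f i)) /\ g = (fun x => G (\row_(i < k) f i x))].

Definition affine_class (R : realType) (d : nat) (rho : R) :
    set (unit_ball R d -> R) :=
  [set f | exists (w : 'rV[R]_d) (b : R),
    Num.max (enorm w) `|b| <= rho /\ f = (fun x : unit_ball R d => dotp w (val x) + b)].

(* A label y in {-1,1} is encoded by a Boolean b standing for (-1) ^+ b. *)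
Definition hinge_class (R : realType) (d : nat) (rho : R) :
    set (unit_ball R d * bool -> R) :=
  [set h | exists2 f : unit_ball R d -> R, affine_class rho f &
    h = (fun z : unit_ball R d * bool => Num.max 0 (1 - (-1) ^+ z.2 * f z.1))].

(* Main.v *)
(* A linear functional u on m points of norm at most sqrt 2 is approximated to
   within eps at all of them by a signed combination of the points, with integer
   multiplicities of total at most 2 |u|^2 / eps^2: run the perceptron algorithm.
   With eps = gamma / (2 L), the approximations of all k coordinates are jointly
   gamma / 2-accurate after aggregation, and they are coded by one vector of
   2 k m multiplicities of total at most N, where N is about
   16 L^2 / gamma^2 * sum_i R_i^2. Coding all k classes together, rather than
   class by class, leads directly to the factor Log k: there are at most
   (16 k)^N exp (m / 4) codes, while gamma-shattering m points requires 2^m. *)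

Require Import Defs.
From HB Require Import structures.
From mathcomp Require Import all_boot all_order all_algebra.
From mathcomp Require Import all_classical all_reals all_analysis.
From mathcomp Require Import ring lra.

Set Implicit Arguments.
Unset Strict Implicit.
Unset Printing Implicit Defensive.

Import Order.TTheory GRing.Theory Num.Theory.
Import numFieldNormedType.Exports.

Local Open Scope classical_set_scope.
Local Open Scope ring_scope.

(** * Euclidean inner product *)

Lemma dotpC (R : realType) n (u v : 'rV[R]_n) : dotp u v = dotp v u.
Proof. by apply: eq_bigr => j _; rewrite mulrC. Qed.

Lemma dotpBl (R : realType) n (u v w : 'rV[R]_n) :
  dotp (u - v) w = dotp u w - dotp v w.
Proof. by rewrite /dotp -sumrB; apply: eq_bigr => j _; rewrite !mxE mulrBl. Qed.

Lemma dotpZl (R : realType) n a (u v : 'rV[R]_n) :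
  dotp (a *: u) v = a * dotp u v.
Proof. by rewrite /dotp mulr_sumr; apply: eq_bigr => j _; rewrite mxE mulrA. Qed.

Lemma dotp_ge0 (R : realType) n (u : 'rV[R]_n) : 0 <= dotp u u.
Proof. by apply: sumr_ge0 => j _; rewrite -expr2 sqr_ge0. Qed.

Lemma dotp_row_mx (R : realType) n1 n2 (u v : 'rV[R]_n1) (u' v' : 'rV[R]_n2) :
  dotp (row_mx u u') (row_mx v v') = dotp u v + dotp u' v'.
Proof.
rewrite /dotp big_split_ord /=.
by congr (_ + _); apply: eq_bigr => j _; rewrite ?row_mxEl ?row_mxEr.
Qed.

(** * Perceptron approximation; [c (i, b)] counts the steps of length factor [eps / 2] along
    [(-1) ^+ b *: z i], so that multiplicities stay natural numbers *)

Definition signed_comb (R : realType) n (I : finType) (eps : R)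
    (z : I -> 'rV[R]_n) (c : I * bool -> nat) : 'rV[R]_n :=
  \sum_p ((c p)%:R * ((-1) ^+ p.2 * (eps / 2))) *: z p.1.

(* The perceptron algorithm: while some [z i] witnesses [`|<u, z i>| > eps],
   replace [u] by [u -+ (eps / 2) z i]; each step lowers [|u|^2] by at least
   [eps^2 / 2]. *)
Lemma perceptron_cover (R : realType) n (I : finType) (eps : R)
    (z : I -> 'rV[R]_n) (u : 'rV[R]_n) :
  0 < eps -> (forall i, dotp (z i) (z i) <= 2) ->
  exists c : I * bool -> nat,
    (\sum_p c p)%:R * (eps ^+ 2 / 2) <= dotp u u /\
    forall i, `|dotp (u - signed_comb eps z c) (z i)| <= eps.
Proof.
move=> eps0 z2.
have e20 : 0 < eps ^+ 2 / 2 by rewrite divr_gt0 // exprn_gt0.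
have [t] : exists t : nat, dotp u u < t%:R * (eps ^+ 2 / 2).
  exists (Num.truncn (dotp u u / (eps ^+ 2 / 2))).+1.
  by rewrite -ltr_pdivrMr // truncnS_gt.
elim: t u => [|t IHt] u; first by rewrite mul0r ltNge dotp_ge0.
move=> ut.
have [small|/existsNP[i /negP]] := pselect (forall i, `|dotp u (z i)| <= eps).
  exists (fun=> 0%N); rewrite big1 // mul0r dotp_ge0; split=> // i.
  rewrite /signed_comb big1 ?subr0 // => p _.
  by rewrite mul0r scale0r.
rewrite -ltNge => large.
have [b hb] : exists b : bool, (-1) ^+ b * dotp u (z i) = `|dotp u (z i)|.
  exists (dotp u (z i) < 0); rewrite [RHS]normrEsign //.
set s : R := (-1) ^+ b * (eps / 2).
(* The cross term [2 s <u, z i>] gains at least [eps ^+ 2], while the quadratic term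
   [s ^+ 2 |z i|^2] costs at most [eps ^+ 2 / 2]. *)
have drop : dotp (u - s *: z i) (u - s *: z i) <= dotp u u - eps ^+ 2 / 2.
  rewrite dotpBl [dotp u _]dotpC dotpBl !dotpZl.
  rewrite [dotp (z i) (_ - _)]dotpC dotpBl dotpZl [dotp (z i) u]dotpC.
  have -> : s * dotp u (z i) = eps / 2 * `|dotp u (z i)|.
    by rewrite -hb /s; ring.
  have ss : s * s = eps ^+ 2 / 4.
    have := sqrr_sign R b; rewrite /s; set e := (-1) ^+ b => h.
    by transitivity (e ^+ 2 * (eps ^+ 2 / 4)); [field|rewrite h mul1r].
  have h1 : s * s * dotp (z i) (z i) <= eps ^+ 2 / 4 * 2.
    by rewrite ss ler_pM2l // divr_gt0 // exprn_gt0.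
  have h2 : eps / 2 * eps <= eps / 2 * `|dotp u (z i)|.
    by rewrite ler_pM2l ?divr_gt0// ltW.
  have h3 : s * (dotp u (z i) - s * dotp (z i) (z i)) =
     eps / 2 * `|dotp u (z i)| - s * s * dotp (z i) (z i).
    by rewrite -hb /s; ring.
  rewrite h3; lra.
have [|c [csum cov]] := IHt (u - s *: z i).
  by apply: le_lt_trans drop _; move: ut; rewrite -natr1 mulrDl mul1r; lra.
exists (fun p => c p + (p == (i, b)))%N; split.
  have -> : (\sum_p (c p + (p == (i, b))) = \sum_p c p + 1)%N.
    rewrite big_split /=; congr (_ + _)%N.
    by rewrite (bigD1 (i, b)) //= eqxx big1 // => p /negbTE ->.
  by rewrite natrD mulrDl mul1r; lra.
move=> j; suff -> : signed_comb eps z (fun p => c p + (p == (i, b)))%N =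
  s *: z i + signed_comb eps z c by rewrite opprD addrA; exact: cov.
rewrite /signed_comb [in RHS]addrC.
under eq_bigr do rewrite natrD mulrDl scalerDl.
rewrite big_split /=; congr (_ + _).
rewrite (bigD1 (i, b)) //= eqxx mul1r big1 ?addr0 // => p /negbTE ->.
by rewrite mul0r scale0r.
Qed.

(** * Counting codes against sign patterns *)

(* Weigh the code [c] by [x ^+ \sum c] and sum the resulting product of
   geometric series. *)
Lemma card_bounded_sum_ffun (R : realType) (A : finType) N (x : R) :
  0 < x -> x <= 1 / 2 ->
  #|[pred c : {ffun A -> 'I_N.+1} | (\sum_a c a <= N)%N]|%:R * x ^+ N <=
  expR (2 * x * #|A|%:R).
Proof.
move=> x0 x2.
(* The geometric sum is at most [1 / (1 - x)], which is at most [1 + 2 * x] as [x <= 1 / 2]. *)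
have geo : \sum_(j < N.+1) x ^+ j <= expR (2 * x).
  apply: (@le_trans _ _ (1 + 2 * x)); last exact: expR_ge1Dx.
  have x1 : 0 < 1 - x by lra.
  rewrite -(ler_pM2l x1) -[X in X <= _]opprK -mulNr opprB -subrX1.
  have := exprn_gt0 N.+1 x0.
  have : x * x <= x * (1 / 2) by rewrite ler_pM2l.
  lra.
apply: (@le_trans _ _ (\prod_(a : A) \sum_(j < N.+1) x ^+ j)); last first.
  rewrite mulrC expRM_natl.
  rewrite prodr_const; apply: lerXn2r; rewrite ?nnegrE ?expR_ge0//.
  by apply: sumr_ge0 => j _; rewrite exprn_ge0 // ltW.
rewrite bigA_distr_bigA /=.
(* Codes of total above [N] are dropped; each of the others weighs at least [x ^+ N]. *)
rewrite [leRHS](bigID (fun c : {ffun A -> 'I_N.+1} => (\sum_a c a <= N)%N)) /=.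
rewrite -[leLHS]addr0 lerD //; last first.
  by apply: sumr_ge0 => c _; apply: prodr_ge0 => a _; rewrite exprn_ge0 // ltW.
rewrite -sum1_card natr_sum mulr_suml.
apply: ler_sum => c cN; rewrite mul1r prodrXr.
by apply: ler_wiXn2l => //; lra.
Qed.

(** Comparing an approximant with the witness [r] recovers the sign pattern, because the margin
    exceeds the error [gamma / 2]; hence distinct patterns need distinct codes. *)
Lemma shattered_card_le (R : realType) (T : Type) (F : set (T -> R)) (gamma : R)
    m (x : 'I_m -> T) (A : finType) (S : {pred A}) (g : A -> 'I_m -> R) :
  0 < gamma -> shattered F gamma x ->
  (forall f, F f -> exists2 a, a \in S &
     forall i, `|f (x i) - g a i| <= gamma / 2) ->
  (2 ^ m <= #|S|)%N.
Proof.
move=> g0 sh cov.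
(* The suprema need not be attained; the strict drop to [gamma / 2] yields actual [r] and [f]. *)
have : ((gamma / 2)%:E < gamma%:E)%E by rewrite lte_fin; lra.
move=> /lt_le_trans/(_ sh)/ereal_sup_gt[_ [r _ <-]] /bigmin_gtP[_ hr].
have code (y : {ffun 'I_m -> bool}) : exists2 a, a \in S &
    forall i, y i = (g a i < r i).
  have /ereal_sup_gt[_ [f Ff <-] /bigmin_gtP[_ hf]] := hr y isT.
  have [a aS ha] := cov f Ff; exists a => // i.
  move: (hf i isT) (ha i); rewrite lte_fin ler_norml => /[swap] /andP[].
  case: (y i) => /=; rewrite ?expr1 ?expr0 => ? ? ?; apply/esym.
    by lra.
  by apply/negbTE; rewrite -leNgt; lra.
pose dec a : {ffun 'I_m -> bool} := [ffun i => g a i < r i].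
have sub : predT \subset dec @: S.
  apply/fintype.subsetP => y _; have [a aS ya] := code y.
  by apply/imsetP; exists a => //; apply/ffunP => i; rewrite ffunE ya.
have := leq_trans (subset_leq_card sub) (leq_imset_card _ _).
by rewrite card_ffun card_bool card_ord.
Qed.

Lemma Log_ge1 (R : realType) (x : R) : 1 <= Log x.
Proof.
by rewrite -[leLHS]expRK ler_ln ?posrE ?lt_max ?le_max ?expR_gt0 ?lexx.
Qed.

Lemma ln_le_Log (R : realType) (x : R) : 0 < x -> ln x <= Log x.
Proof.
by move=> x0; rewrite ler_ln ?posrE ?lt_max ?le_max ?expR_gt0 ?lexx ?orbT.
Qed.

(* At [x = 1 / (16 k)] the exponential then
   costs only [m / 4 < m ln 2], and [x ^- N] costs [N ln (16 k)]. *)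
Lemma exponent_bound (R : realType) (k m N n : nat) :
  (0 < k)%N -> (2 ^ m <= n)%N ->
  n%:R * (16 * k%:R)^-1 ^+ N <=
    expR (2 * (16 * k%:R)^-1 * (k * (m * 2))%:R) :> R ->
  m%:R <= 64 * N%:R * Log (k%:R : R).
Proof.
move=> k0 mn nle.
have kR : 0 < k%:R :> R by rewrite ltr0n.
have K0 : 0 < 16 * k%:R :> R by rewrite mulr_gt0.
have e : 2 * (16 * k%:R)^-1 * (k * (m * 2))%:R = m%:R / 4 :> R.
  by rewrite !natrM; field; rewrite gt_eqF.
rewrite e exprVn ler_pdivrMr ?exprn_gt0 // in nle.
(* This turns [2 ^+ m] into [expR (m / 2)], so that half of the exponent survives the cost
   [m / 4]. *)
have two : expR (1 / 2) <= 2 :> R.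
  have := expR_ge1Dx (- (1 / 2) : R); rewrite expRN.
  have p := expR_gt0 (1 / 2 : R) => h.
  rewrite -(ler_pV2) ?inE ?unitfE ?gt_eqF ?p //; lra.
have : expR (m%:R / 2) <= expR (m%:R / 4 + N%:R * ln (16 * k%:R)) :> R.
  rewrite expRD expRM_natl lnK ?posrE //.
  apply: le_trans nle; rewrite -[2^-1]div1r expRM_natl.
  apply: (@le_trans _ _ (2 ^+ m)).
    by apply: lerXn2r; rewrite ?nnegrE ?expR_ge0.
  by rewrite -natrX ler_nat.
rewrite ler_expR lnM ?posrE // => h.
have l16 : ln 16 <= 15 :> R.
  by rewrite (_ : 16 = 1 + 15) ?le_ln1Dx; lra.
have h1 : ln 16 + ln k%:R <= 16 * Log k%:R :> R.
  by have := ln_le_Log kR; have := Log_ge1 (k%:R : R); lra.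
have : N%:R * (ln 16 + ln k%:R) <= N%:R * (16 * Log k%:R) :> R.
  by rewrite ler_wpM2l.
lra.
Qed.

(** The 1-Lipschitz maps [h t] let one argument serve both classes: the identity for affine
    functions, the hinge loss for the others. *)
Lemma fat_aggregate_le (R : realType) (T : Type) n k (z : T -> 'rV[R]_n)
    (h : T -> R -> R) (rho : 'I_k -> R) (F : 'I_k -> set (T -> R))
    (L gamma : R) (G : 'rV[R]_k -> R) :
  (0 < k)%N -> 0 < L -> 0 < gamma ->
  (forall x x' : 'rV[R]_k,
     `|G x - G x'| <= L * \big[Num.max/0]_(i < k) `|x 0 i - x' 0 i|) ->
  (forall t, dotp (z t) (z t) <= 2) ->
  (forall t a b, `|h t a - h t b| <= `|a - b|) ->
  (forall i f, F i f -> exists2 u, dotp u u <= 2 * rho i ^+ 2 &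
     forall t, f t = h t (dotp u (z t))) ->
  (fat gamma (aggregate G F) <=
   (1024 * L ^+ 2 * Log k%:R / gamma ^+ 2 * \sum_(i < k) rho i ^+ 2)%:E)%E.
Proof.
move=> k0 L0 g0 GL z2 h1 hF.
apply: ge_ereal_sup => _ [m [x [_ sh]] <-]; rewrite lee_fin.
set V := \sum_(i < k) _.
have V0 : 0 <= V by apply: sumr_ge0 => i _; rewrite sqr_ge0.
pose eps := gamma / (2 * L).
have eps0 : 0 < eps by rewrite divr_gt0 // mulr_gt0.
have e20 : 0 < eps ^+ 2 / 2 by rewrite divr_gt0 // exprn_gt0.
have W0 : 0 <= 2 * V / (eps ^+ 2 / 2).
  by rewrite (divr_ge0 _ (ltW e20)) // mulr_ge0.
(* The perceptron budgets of all [k] coordinates, added up. The total multiplicity is an integer, so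
   rounding down is safe and no additive term appears. *)
pose N := Num.truncn (2 * V / (eps ^+ 2 / 2)).
have NV : N%:R <= 16 * L ^+ 2 / gamma ^+ 2 * V.
  apply: (@le_trans _ _ (2 * V / (eps ^+ 2 / 2))).
    by rewrite truncn_le.
  rewrite le_eqVlt; apply/predU1l; rewrite /eps; field.
  by rewrite !gt_eqF.
pose A := ('I_k * ('I_m * bool))%type.
pose g (c : {ffun A -> 'I_N.+1}) j := G (\row_i h (x j)
  (dotp (signed_comb eps (z \o x) (fun p => c (i, p))) (z (x j)))).
have card : (2 ^ m <=
    #|[pred c : {ffun A -> 'I_N.+1} | (\sum_a c a <= N)%N]|)%N.
  apply: (shattered_card_le (g := g) g0 sh) => _ [f [Ff ->]].
  have /choice[c hc] : forall i, exists c : 'I_m * bool -> nat,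
      (\sum_p c p)%:R * (eps ^+ 2 / 2) <= 2 * rho i ^+ 2 /\
      forall j, `|f i (x j) -
        h (x j) (dotp (signed_comb eps (z \o x) c) (z (x j)))| <= eps.
    move=> i; have [u u2 fu] := hF i (f i) (Ff i).
    have [c [c1 c2]] := perceptron_cover u eps0 (fun j => z2 (x j)).
    exists c; split=> [|j]; first exact: le_trans u2.
    rewrite fu; apply: le_trans (h1 _ _ _) _.
    by rewrite -dotpBl; exact: c2.
  have cN : (\sum_i \sum_p c i p <= N)%N.
    rewrite truncn_ge_nat //.
    rewrite ler_pdivlMr // natr_sum mulr_suml mulr_sumr.
    by apply: ler_sum => i _; have [] := hc i.
  (* Each multiplicity fits in ['I_N.+1], so [inord] below keeps its value. *)
  have cN1 i p : (c i p < N.+1)%N.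
    rewrite ltnS; apply: leq_trans cN.
    by rewrite (bigD1 i) //= (bigD1 p) //= -addnA leq_addr.
  exists [ffun a => inord (c a.1 a.2)].
    rewrite inE (eq_bigr (fun a : A => c a.1 a.2)) /=; last first.
      by move=> a _; rewrite ffunE inordK.
    by rewrite -(pair_bigA _ c).
  move=> j; rewrite /g; apply: le_trans (GL _ _) _.
  have -> : gamma / 2 = L * eps by rewrite /eps; field; rewrite gt_eqF.
  rewrite ler_pM2l //; apply: bigmax_le => [|i _]; first exact: ltW.
  rewrite !mxE; have [_ /(_ j)] := hc i.
  congr (`| _ - h _ (dotp _ _)| <= _).
  by apply: eq_bigr => p _; rewrite ffunE inordK.
have K0 : 0 < (16 * k%:R)^-1 :> R by rewrite invr_gt0 mulr_gt0 // ltr0n.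
have K2 : (16 * k%:R)^-1 <= 1 / 2 :> R.
  rewrite div1r lef_pV2 ?posrE ?mulr_gt0 ?ltr0n //.
  have : 1 <= k%:R :> R by rewrite ler1n.
  lra.
have := @card_bounded_sum_ffun R A N _ K0 K2.
rewrite card_prod card_prod !card_ord card_bool => /(exponent_bound k0 card).
move=> /le_trans; apply.
have -> : 1024 * L ^+ 2 * Log k%:R / gamma ^+ 2 * V =
  64 * (16 * L ^+ 2 / gamma ^+ 2 * V) * Log k%:R by ring.
by rewrite ler_pM2r ?ler_pM2l // (lt_le_trans ltr01) ?Log_ge1.
Qed.

(** * Affine and hinge classes on the ball *)

Lemma unit_ball_dotp_le1 (R : realType) d (x : unit_ball R d) :
  dotp (val x) (val x) <= 1.
Proof.
have := valP x; rewrite /enorm /= => h.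
by rewrite -(sqr_sqrtr (dotp_ge0 _)) expr_le1 ?sqrtr_ge0.
Qed.

(* An affine function on the ball is linear in the lift [(x, 1)] of norm at
   most [sqrt 2]. *)
Lemma affine_class_lift (R : realType) d (rho : R) (f : unit_ball R d -> R) :
  affine_class rho f ->
  exists2 u : 'rV[R]_(d + 1), dotp u u <= 2 * rho ^+ 2 &
    forall x, f x = dotp u (row_mx (val x) (const_mx 1)).
Proof.
move=> [w [b [+ ->]]]; rewrite ge_max => /andP[hw hb].
exists (row_mx w (const_mx b)) => [|x]; last first.
  by rewrite dotp_row_mx /dotp [X in _ = _ + X]big_ord1 !mxE mulr1.
rewrite dotp_row_mx [X in _ + X]/dotp big_ord1 !mxE -expr2 mulr2n mulrDl !mul1r.
have sq a : 0 <= a -> a <= rho -> a ^+ 2 <= rho ^+ 2.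
  by move=> a0 ar; rewrite lerXn2r ?nnegrE // (le_trans a0).
apply: lerD; last by rewrite -real_normK ?num_real // sq.
by rewrite -(sqr_sqrtr (dotp_ge0 w)) sq ?sqrtr_ge0.
Qed.

Lemma dist_hinge (R : realDomainType) (s : bool) (a b : R) :
  `|Num.max 0 (1 - (-1) ^+ s * a) - Num.max 0 (1 - (-1) ^+ s * b)| <= `|a - b|.
Proof.
rewrite -[leRHS](normrMsign s) mulrBr.
move: (_ * a) (_ * b) => {}a {}b.
by rewrite /Num.max; case: ltP => ?; case: ltP => ?;
  rewrite ler_norml; case: (lerP a b) => ?; apply/andP; split; lra.
Qed.

Theorem theorem3 (R : realType) :
  exists2 C : R, 0 < C &
    forall (d k : nat) (rho : 'I_k -> R) (L : R) (G : 'rV[R]_k -> R),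
      (0 < k)%N -> 0 < L ->
      (forall x x' : 'rV[R]_k,
         `|G x - G x'| <= L * \big[Num.max/0]_(i < k) `|x 0 i - x' 0 i|) ->
      forall gamma : R,
        0 < gamma / L -> (forall i, gamma / L < rho i) ->
        (fat gamma (aggregate G (fun i => @affine_class R d (rho i)))
           <= (C * L ^+ 2 * Log k%:R / gamma ^+ 2
               * \sum_(i < k) rho i ^+ 2)%:E)%E /\
        (fat gamma (aggregate G (fun i => @hinge_class R d (rho i)))
           <= (C * L ^+ 2 * Log k%:R / gamma ^+ 2
               * \sum_(i < k) rho i ^+ 2)%:E)%E.
Proof.
(* [1024 = 64 * 16]: 64 from the exponent comparison, 16 from the bound on [N]. *)
exists 1024; first by rewrite ltr0n.
move=> d k rho L G k0 L0 GL gamma + _.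
rewrite pmulr_lgt0 ?invr_gt0 // => g0.
pose lift (x : unit_ball R d) : 'rV[R]_(d + 1) := row_mx (val x) (const_mx 1).
have lift2 x : dotp (lift x) (lift x) <= 2.
  rewrite dotp_row_mx [X in _ + X]/dotp big_ord1 !mxE mulr1.
  by have := unit_ball_dotp_le1 x; lra.
split.
  apply: (fat_aggregate_le (z := lift) (h := fun=> id)) => //.
  by move=> i f; exact: affine_class_lift.
apply: (fat_aggregate_le (z := fun t : unit_ball R d * bool => lift t.1)
  (h := fun t a => Num.max 0 (1 - (-1) ^+ t.2 * a))) => //.
  by move=> t a b; exact: dist_hinge.
move=> i _ [f /affine_class_lift[u u2 fu] ->]; exists u => // t.
by rewrite fu.
Qed.
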